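(* For infinitely many primes $p$, there exist an integer $k=k(p)\geq 2$ with $p\geq k+1$ and an integer vector $\mathbf{i}\in\mathbb{Z}_{\geq 0}^k$ for which the following assertion is false: for every $\varepsilon>0$ there is an $M=M(\varepsilon,k,p)>0$ such that for every positive integer $n$, every dual function $\phi\in\Delta_{\mathbf{i}}$ over $G=\mathbb{F}_p^n$ can be decomposed as $$\phi=\sum_{j=1}^{r}\alpha_j\psi_j+\tau,$$ where $r$ is a non-negative integer, $\alpha_1,\dots,\alpha_r\in\mathbb{C}$ satisfy $|\alpha_1|+\cdots+|\alpha_r|\leq M$, the functions $\psi_1,\dots,\psi_r$ are polynomial phases of degree at most $k-1$ on $\mathbb{F}_p^n$, and $\tau:\mathbb{F}_p^n\to\mathbb{C}$ satisfies $\|\tau\|_{L_\infty}\leq\varepsilon$. Equivalently, for such $p$, $k$ and $\mathbf{i}$ there is an $\varepsilon>0$ such that for every $M>0$ there are a positive integer $n$ and a function $\phi\in\Delta_{\mathbf{i}}$ over $\mathbb{F}_p^n$ that admits no such decomposition.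
   Context: $\mathbb{D}$ denotes the closed complex unit disc $\{z\in\mathbb{C}: |z|\leq 1\}$. For $k\geq 2$, an integer vector $\mathbf{i}=(i_1,\dots,i_k)\in\mathbb{Z}_{\geq 0}^k$ and a finite abelian group $G$, the set of order-$k$ dual functions over $G$ is the set of functions $G\to\mathbb{C}$ $$\Delta_{\mathbf{i}}=\Big\{\phi: y\mapsto \mathbb{E}_{x\in G}\, f_1(x+i_1y)\cdots f_k(x+i_ky)\ \Big|\ f_1,\dots,f_k:G\to\mathbb{D}\Big\},$$ where $\mathbb{E}_{x\in G}$ denotes the average $\frac{1}{|G|}\sum_{x\in G}$. A polynomial phase (function) of degree at most $d$ on $\mathbb{F}_p^n$ is a function $\psi:\mathbb{F}_p^n\to\mathbb{D}$ of the form $\psi(x)=e^{2\pi i P(x)/p}$, where $P\in\mathbb{F}_p[x_1,\dots,x_n]$ is a polynomial of degree at most $d$ (in the exponent, $i$ is the imaginary unit). $\|\tau\|_{L_\infty}=\max_{x\in\mathbb{F}_p^n}|\tau(x)|$. *)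

(* Defs.v *)
From mathcomp Require Import all_boot all_order all_algebra.
From mathcomp Require Import reals trigo.
From mathcomp Require Import complex.
From mathcomp Require Import mpoly.

Set Implicit Arguments.
Unset Strict Implicit.
Unset Printing Implicit Defensive.

Import Order.TTheory GRing.Theory Num.Theory.

Local Open Scope ring_scope.
Local Open Scope complex_scope.

(* Real-valued complex modulus; the generic norm [`|z|] is [R[i]]-valued. *)
Definition cabs (R : realType) (z : R[i]) : R := ComplexField.Normc.normc z.

Definition in_disc (R : realType) (z : R[i]) : Prop := cabs z <= 1.

Definition average (R : realType) (G : finZmodType) (F : G -> R[i]) : R[i] :=
  (#|G|%:R)^-1 * \sum_(x : G) F x.

Definition dual_function (R : realType) (G : finZmodType) (k : nat)
    (v : 'I_k -> nat) (phi : G -> R[i]) : Prop :=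
  exists f : 'I_k -> G -> R[i],
    (forall (j : 'I_k) (x : G), in_disc (f j x)) /\
    (forall y : G, phi y = average (fun x => \prod_(j < k) f j (x + y *+ v j))).

(* exp(i t), by Euler's formula. *)
Definition expi (R : realType) (t : R) : R[i] := cos t +i* sin t.

(* [msize P] is one more than the total degree of P (and 0 for P = 0).  The value
   P(x) is an element of 'F_p, represented by an integer in {0, ..., p - 1}. *)
Definition polynomial_phase (R : realType) (p n d : nat)
    (psi : 'rV['F_p]_n -> R[i]) : Prop :=
  exists P : {mpoly 'F_p[n]},
    (msize P <= d.+1)%N /\
    (forall x : 'rV['F_p]_n,
       psi x = expi (2 * pi * (nat_of_ord (P.@[x 0]))%:R / p%:R)).

Definition Linfty_norm (R : realType) (T : finType) (tau : T -> R[i]) : R :=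
  \big[Num.max/0]_(x : T) cabs (tau x).

Definition decomposable (R : realType) (p n d : nat) (M eps : R)
    (phi : 'rV['F_p]_n -> R[i]) : Prop :=
  exists (r : nat) (alpha : 'I_r -> R[i]) (psi : 'I_r -> 'rV['F_p]_n -> R[i])
         (tau : 'rV['F_p]_n -> R[i]),
    [/\ \sum_(j < r) cabs (alpha j) <= M,
        forall j : 'I_r, polynomial_phase d (psi j),
        Linfty_norm tau <= eps
      & forall x : 'rV['F_p]_n,
          phi x = \sum_(j < r) alpha j * psi j x + tau x].

(* Main.v *)
Require Import Defs.
From mathcomp Require Import all_boot all_order all_algebra.
From mathcomp Require Import reals sequences exp trigo.
From mathcomp Require Import complex.
From mathcomp Require Import mpoly.
From mathcomp Require Import ring lra zify.

(** Polynomial phases of degree at most [k - 1] in [n] variables are too few,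
    roughly exp(O(n^(k-1))) of them, to approximate all dual functions of order
    [k]: for suitable [p], [k] and shifts, the dual functions can realise every
    sign pattern on a set of about n^k points, and a random sign pattern is
    nearly orthogonal to every polynomial phase.

    Let [p] be a prime with p = 3 mod 4 modulo which 2 is a square; a prime
    divisor of 8 (N!)^2 - 1 is of this kind and exceeds [N]
    ([prime_3_mod_4_with_sqrt2]).  Let Q be the set of nonzero squares of F_p,
    take k = |Q| = (p-1)/2, which is odd, and let the shifts be the elements
    of Q.

    The heart of the matter is the function h on F_p that is the indicator of
    {0} and of -Q.  In the group algebra over F_2, the sum e of the X^q with q
    in Q is idempotent, because squaring permutes its exponents when 2 is in Q;
    so e (1 + e) = 0, that is, h sums to an even number over every translate
    of Q, hence over every translate of s Q with s in Q
    ([prod_sign_shifted_squares]).  (This e is the idempotent of a binary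
    quadratic residue code.)

    Now let L_i be linear forms on F_p^n and y_i points with L_i(y_i) = 0 and
    L_i(y_j) in Q when i and j differ.  For a set S of indices, let f be the
    product of the (-1)^h(L_i) with i in S.  In the product of the f(x + q y_j)
    over q in Q, the factors with index i <> j cancel by the parity of h; the
    factor j, if present, is (-1)^h(L_j(x)) because |Q| is odd.  So the dual
    function built from [k] copies of f equals 1 at y_j when j is not in S, and
    the average -1/p of (-1)^h when j is in S ([dual_function_of_signs]).
    Such a dual function correlates with the sign pattern of S: the signed sum of its
    values is at least 1/p times the number of points.

    Such forms and points are obtained from N^(p-1) words of length p - 1 by
    letting L_i(y_j) be the square of one plus the number of agreements of the
    words i and j.  They live in dimension n of order N^2, so there are of order
    n^k of them ([matching_family]).  There are only p^(O(n^(k-1))) polynomial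
    phases of degree less than [k], and an exponential moment bound provides
    signs that correlate with none of them ([signs_uncorrelated_with_phases]),
    hence with no combination of them of bounded total weight
    ([decomposable_signed_sum_le]).  For large [N] this contradicts the lower
    bound. *)

Set Implicit Arguments.
Unset Strict Implicit.
Unset Printing Implicit Defensive.

Import Order.TTheory GRing.Theory Num.Theory.

Local Open Scope ring_scope.

(** * Primes p = 3 mod 4 modulo which 2 is a square *)

Lemma prime_divisor_3_mod_4 m :
  (m %% 4 = 3 -> exists2 q, prime q & (q %| m) && (q %% 4 == 3))%N.
Proof.
elim/ltn_ind: m => m IH m3.
have m1 : (1 < m)%N by case: m m3 {IH} => [|[|]].
have pr := pdiv_prime m1; have dv := pdiv_dvd m.
set q := pdiv m in pr dv; have [q3|q3] := eqVneq (q %% 4)%N 3.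
  by exists q; rewrite ?dv ?q3.
have mE := divnK dv; have q1 := prime_gt1 pr.
have/IH[] : ((m %/ q)%N < m)%N by apply: ltn_Pdiv; lia.
- have : ((((m %/ q) %% 4) * (q %% 4)) %% 4 = 3)%N by rewrite modnMm mE.
  have := ltn_pmod q (isT : 0 < 4)%N.
  have := ltn_pmod (m %/ q)%N (isT : 0 < 4)%N.
  move: q3; case: (q %% 4)%N => [|[|[|[|]]]] //;
  by case: ((m %/ q) %% 4)%N => [|[|[|[|]]]].
move=> r rp /andP[rd r3]; exists r => //; rewrite r3 andbT.
by apply: dvdn_trans rd _; rewrite -{2}mE dvdn_mulr.
Qed.

(** With x = N!, a prime divisor of 8 x^2 - 1 exceeds [N], and modulo it
    (4 x)^2 = 2 (8 x^2) = 2.  As 8 x^2 - 1 is 3 mod 4, one of its prime divisors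
    is 3 mod 4. *)
Lemma prime_3_mod_4_with_sqrt2 N :
  exists p,
    [/\ (N < p)%N, prime p, (p %% 4 = 3)%N & exists b : 'F_p, b ^+ 2 = 2].
Proof.
pose x := N`!; have x0 : (0 < x)%N by apply: fact_gt0.
have [|p pp /andP[pd /eqP p3]] := @prime_divisor_3_mod_4 (8 * x ^ 2 - 1).
  have : (0 < x ^ 2)%N by rewrite expn_gt0 x0.
  lia.
exists p; split=> //.
  rewrite ltnNge; apply/negP => pN.
  have px : (p %| x)%N by rewrite dvdn_fact // prime_gt0.
  have : (p %| 8 * x ^ 2)%N by rewrite dvdn_mull // dvdn_exp.
  have E : (8 * x ^ 2 = (8 * x ^ 2 - 1) + 1)%N.
    by rewrite subnK // muln_gt0 expn_gt0 x0.
  by rewrite E dvdn_addr // dvdn1 => /eqP p1; move: pp; rewrite p1.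
exists (4 * x)%:R.
have E0 : (8 * x ^ 2 - 1)%N%:R = 0 :> 'F_p.
  by case/dvdnP: pd => c ->; rewrite natrM pchar_Fp_0 // mulr0.
move/eqP: E0; rewrite natrB ?muln_gt0 ?expn_gt0 ?x0 // subr_eq0 => /eqP E.
have -> : ((4 * x)%:R ^+ 2 = 2 * (8 * x ^ 2)%:R :> 'F_p).
  by rewrite !natrM; ring.
by rewrite E mulr1.
Qed.

(** * The nonzero squares of a finite field *)

Lemma odd_card_involution (T : finType) (A : {set T}) (f : T -> T) :
  involutive f -> (forall x, (f x \in A) = (x \in A)) ->
  odd #|A| = odd #|[set x in A | f x == x]|.
Proof.
move=> fK fA.
(* Of the two points of a nontrivial orbit, exactly one is ranked first. *)
pose r (x : T) : nat := enum_rank x.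
have rE x y : (r x == r y) = (x == y).
  by apply/eqP/eqP => [/val_inj/enum_rank_inj|->].
pose lt_sum := (\sum_(x in A) (r x < r (f x)))%N.
have lt_sumE : (\sum_(x in A) (r (f x) < r x) = lt_sum)%N.
  rewrite (reindex_inj (inv_inj fK)) /=.
  by apply: eq_big => x; rewrite ?fA ?fK.
have -> : #|A| = (\sum_(x in A) (f x == x) + lt_sum.*2)%N.
  rewrite -sum1_card -addnn -{1}lt_sumE -!big_split /=; apply: eq_bigr => x _.
  by rewrite -rE; case: ltngtP.
rewrite oddD odd_double addbF; congr odd.
rewrite -sum1_card big_mkcond [RHS]big_mkcond /=.
by apply: eq_bigr => x _; rewrite !inE; case: (x \in A); case: eqP.
Qed.

Definition nonzero_squares (F : finFieldType) : {set F} :=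
  [set x ^+ 2 | x in [set~ 0]].

Lemma nonzero_squaresP (F : finFieldType) (q : F) :
  reflect (exists2 x, x != 0 & q = x ^+ 2) (q \in nonzero_squares F).
Proof.
apply: (iffP imsetP) => -[x x0 ->]; exists x => //; move: x0;
by rewrite !inE.
Qed.

Lemma nonzero_squaresN0 (F : finFieldType) (q : F) :
  q \in nonzero_squares F -> q != 0.
Proof. by case/nonzero_squaresP => x x0 ->; rewrite expf_neq0. Qed.

Lemma nonzero_squaresMl (F : finFieldType) (s q : F) :
  s \in nonzero_squares F ->
  (s * q \in nonzero_squares F) = (q \in nonzero_squares F).
Proof.
case/nonzero_squaresP => x x0 ->; apply/nonzero_squaresP/nonzero_squaresP.
- case=> y y0 /(canRL (mulKf (expf_neq0 2 x0))) ->.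
  exists (x^-1 * y); first by rewrite mulf_neq0 ?invr_eq0.
  by rewrite exprMn exprVn.
- by case=> y y0 ->; exists (x * y); rewrite ?mulf_neq0 ?exprMn.
Qed.

Lemma card_nonzero_squares (F : finFieldType) :
  (2 : F) != 0 -> #|F| = (#|nonzero_squares F|).*2.+1.
Proof.
move=> two0.
have -> : #|F| = (#|[set~ 0 : F]|).+1 by rewrite cardsC1 prednK // (cardD1 0).
congr _.+1; rewrite -sum1_card.
rewrite (partition_big (fun x => x ^+ 2) (mem (nonzero_squares F))) /=;
  last first.
  by move=> x; rewrite !inE => x0; apply/nonzero_squaresP; exists x.
rewrite -muln2 -sum_nat_const; apply: eq_bigr => q /nonzero_squaresP[x x0 ->].
rewrite sum1dep_card; transitivity #|[set x; - x]|; last first.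
  rewrite cards2 -addr_eq0 -mulr2n -mulr_natr mulf_eq0 (negbTE x0).
  by rewrite (negbTE two0).
apply: eq_card => y; rewrite !inE eqf_sqr.
have [->|_] := eqVneq y x; first by rewrite x0.
by have [->|_] := eqVneq y (- x); rewrite ?oppr_eq0 ?x0 ?andbF.
Qed.

(** An element of the group algebra over F_2 that annihilates, by correlation,
    the sum of the nonzero squares when 2 is a square: up to reflection, the
    idempotent complementary to that sum. *)
Definition zero_or_negsquare (F : finFieldType) (a : F) : bool :=
  (a == 0) || (- a \in nonzero_squares F).

Lemma card_zero_or_negsquare (F : finFieldType) :
  #|[pred a | zero_or_negsquare (F := F) a]| = (#|nonzero_squares F|).+1.
Proof.
rewrite (cardD1 0) inE /zero_or_negsquare eqxx /= add1n; congr _.+1.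
rewrite -(card_imset _ (@oppr_inj F)); apply: eq_card => a.
apply/imsetP/idP.
- by case=> q; rewrite !inE => /andP[/negbTE -> Qq] ->.
- move=> Qa; exists (- a); last by rewrite opprK.
  by rewrite !inE opprK Qa oppr_eq0 orbT (nonzero_squaresN0 Qa).
Qed.

(** Let Q be the set of nonzero squares.  The exponents sum to [- c \in Q] plus
    the number of q in Q with - c - q in Q.  The involution q |-> - c - q acts on
    these q with the single possible fixed point - c / 2, which lies in Q exactly
    when - c does, as 2 is in Q.  So the sum is even. *)
Lemma prod_sign_shifted_squares (F : finFieldType) (R : pzRingType) (c : F) :
  2 \in nonzero_squares F ->
  \prod_(q in nonzero_squares F) (-1) ^+ zero_or_negsquare (c + q) = 1 :> R.
Proof.
move=> Q2; set Q := nonzero_squares F in Q2 *.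
rewrite prodrXr -signr_odd.
have two0 : (2 : F) != 0 := nonzero_squaresN0 Q2.
pose refl q := - c - q.
have reflK : involutive refl by move=> q; rewrite /refl opprB addrC subrK.
pose A := [set q in Q | refl q \in Q].
have reflA q : (refl q \in A) = (q \in A) by rewrite !inE reflK andbC.
have -> : (\sum_(q in Q) zero_or_negsquare (c + q)%R = (- c \in Q)%R + #|A|)%N.
  have -> : (- c \in Q) = (\sum_(q in Q) (q == - c)%R)%N :> nat.
    case: (boolP (- c \in Q)) => [Qc|Qc].
      rewrite (bigD1 (- c)) //= eqxx big1 // => q /andP[_ /negbTE ->] //.
    rewrite big1 // => q Qq; case: eqP => // qc.
    by move: Qc; rewrite -qc Qq.
  have -> : #|A| = (\sum_(q in Q) (refl q \in Q))%N.
    rewrite -sum1_card big_mkcond [RHS]big_mkcond /=.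
    by apply: eq_bigr => q _; rewrite !inE; case: (q \in Q); case: (refl q \in Q).
  rewrite -big_split /=; apply: eq_bigr => q Qq.
  rewrite /zero_or_negsquare opprD -/(refl q) addrC addr_eq0.
  have [qc|//] := eqVneq q (- c); rewrite /refl -qc subrr.
  by case: (boolP (0 \in Q)) => // /nonzero_squaresN0; rewrite eqxx.
rewrite oddD (odd_card_involution reflK reflA).
have -> : [set q in A | refl q == q] = if - c \in Q then [set - c / 2] else set0.
  have fixE q : (refl q == q) = (q == - c / 2).
    rewrite /refl subr_eq -mulr2n -[q *+ 2]mulr_natr eq_sym.
    by rewrite -[q == _ / _](inj_eq (mulIf two0)) divfK.
  apply/setP => q; rewrite inE fixE.
  have [->|qc] := eqVneq q (- c / 2); last first.
    by rewrite andbF; case: ifP => _; rewrite !inE // (negbTE qc).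
  rewrite andbT inE; have -> : refl (- c / 2) = - c / 2.
    by apply/eqP; rewrite fixE.
  rewrite andbb -(nonzero_squaresMl _ Q2) mulrC divfK //.
  by rewrite -/Q; case: (- c \in Q); rewrite !inE ?eqxx.
by case: (- c \in Q); rewrite ?cards1 ?cards0.
Qed.

(** * The modulus of complex numbers *)

Lemma in_disc1 (R : realType) : in_disc (1 : R[i]).
Proof. by rewrite /in_disc /cabs (ComplexField.Normc.normc1 R). Qed.

Lemma in_discM (R : realType) (w z : R[i]) :
  in_disc w -> in_disc z -> in_disc (w * z).
Proof.
rewrite /in_disc /cabs ComplexField.Normc.normcM => w1 z1.
by rewrite mulr_ile1 //; [case: w {w1} => u v | case: z {z1} => u v];
  rewrite /= sqrtr_ge0.
Qed.

Lemma in_disc_sign (R : realType) (b : bool) : in_disc ((-1) ^+ b : R[i]).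
Proof.
case: b; last exact: in_disc1.
by rewrite expr1 /in_disc /cabs /= oppr0 expr0n addr0 sqrrN expr1n sqrtr1.
Qed.

Lemma cabs_le_ReIm (R : realType) (a b : R) :
  cabs (a +i* b)%C <= `|a| + `|b|.
Proof.
rewrite /cabs /= -[leRHS]ger0_norm ?addr_ge0 // -sqrtr_sqr ler_wsqrtr //.
rewrite sqrrD !real_normK ?num_real // -addrA lerD2l lerDr.
by rewrite mulrn_wge0 // mulr_ge0.
Qed.

Lemma Re_le_cabs (R : realType) (z : R[i]) : complex.Re z <= cabs z.
Proof.
case: z => a b; rewrite /cabs /=; apply: le_trans (ler_norm a) _.
by rewrite -sqrtr_sqr ler_wsqrtr // lerDl sqr_ge0.
Qed.

Lemma cabs_sum (R : realType) (I : finType) (F : I -> R[i]) :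
  cabs (\sum_i F i) <= \sum_i cabs (F i).
Proof.
apply: (big_ind2 (fun (z : R[i]) r => cabs z <= r)) => //.
- by rewrite /cabs (ComplexField.Normc.normc0 R).
- by move=> z r w t zr wt; apply: le_trans (le_normcD z w) (lerD zr wt).
Qed.

Lemma sum_sign_expi (R : realType) (I : finType) (s : I -> bool) (t : I -> R) :
  \sum_i (-1) ^+ s i * expi (t i) =
  ((\sum_i (-1) ^+ s i * cos (t i)) +i* (\sum_i (-1) ^+ s i * sin (t i)))%C.
Proof.
apply: (big_rec3 (fun (a b : R) (z : R[i]) => z = (a +i* b)%C)) => // i a b z _ ->.
by apply/eqP; rewrite eq_complex /expi; case: (s i) => /=;
  apply/andP; split; apply/eqP; ring.
Qed.

(** * Dual functions with prescribed values *)

Definition square_shifts (p : nat) (j : 'I_#|nonzero_squares 'F_p|) : nat :=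
  enum_val j.

Lemma prod_square_shifts (R : comPzRingType) (p : nat) (F : 'F_p -> R) :
  \prod_(j < #|nonzero_squares 'F_p|) F (square_shifts j)%:R =
  \prod_(q in nonzero_squares 'F_p) F q.
Proof. by rewrite (big_enum_val F); apply: eq_bigr => j _; rewrite natr_Zp. Qed.

Lemma morphD_mulrn (G : finZmodType) (p : nat) (L : G -> 'F_p) x y m :
  {morph L : x y / x + y} -> L (x + y *+ m) = L x + L y * m%:R.
Proof.
move=> LD; elim: m => [|m IH]; first by rewrite mulr0n mulr0 !addr0.
by rewrite mulrSr addrA LD IH mulrSr mulrDr mulr1 addrA.
Qed.

(** A nonzero additive form is equidistributed: translating by the multiples of
    a point [e] with [L e = 1] permutes the fibres of [L]. *)
Lemma average_comp_morphD (R : realType) (G : finZmodType) (p : nat)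
    (L : G -> 'F_p) (e : G) (g : 'F_p -> R[i]) :
  {morph L : x y / x + y} -> prime p -> L e = 1 ->
  average (fun x => g (L x)) = p%:R^-1 * \sum_c g c.
Proof.
move=> LD pp Le; rewrite /average.
have p0 : p%:R != 0 :> R[i] by rewrite pnatr_eq0 -lt0n prime_gt0.
have G0 : #|G|%:R != 0 :> R[i] by rewrite pnatr_eq0 -lt0n (cardD1 0).
suff E : p%:R * (\sum_x g (L x)) = #|G|%:R * \sum_c g c.
  by apply: (mulfI p0); rewrite mulrCA E mulKf // mulVKf.
transitivity (\sum_(c : 'F_p) \sum_x g (L x + c)).
  have {1}-> : p = #|'F_p| by rewrite card_Fp.
  rewrite mulr_natl -sumr_const; apply: eq_bigr => c _.
  rewrite (reindex_inj (addIr (e *+ c))) /=; apply: eq_bigr => x _.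
  by rewrite (morphD_mulrn _ _ _ LD) Le mul1r natr_Zp.
rewrite exchange_big mulr_natl -sumr_const /=; apply: eq_bigr => x _.
by rewrite [RHS](reindex_inj (addrI (L x))).
Qed.

(** All the functions of the dual function are the product [f] of the signs
    (-1)^h(L i) over the [i] selected by [s], where h is [zero_or_negsquare]. *)
Lemma dual_function_of_signs (R : realType) (p : nat) (G : finZmodType)
    (I : finType) (L : I -> G -> 'F_p) (y : I -> G) (s : I -> bool) :
    prime p -> 2 \in nonzero_squares 'F_p -> odd #|nonzero_squares 'F_p| ->
    (forall i, {morph L i : x z / x + z}) -> (forall i, exists e, L i e = 1) ->
    (forall i, L i (y i) = 0) ->
    (forall i j, i != j -> L i (y j) \in nonzero_squares 'F_p) ->
  exists2 phi : G -> R[i], dual_function (@square_shifts p) phi &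
    forall i, phi (y i) = if s i then - p%:R^-1 else 1.
Proof.
set Q := nonzero_squares 'F_p => pp Q2 Qodd LD Lsurj Lii Lij.
pose g (a : 'F_p) : R[i] := (-1) ^+ zero_or_negsquare a.
pose f z := \prod_i if s i then g (L i z) else 1.
exists (fun z =>
  average (fun x => \prod_(j < #|Q|) f (x + z *+ square_shifts j))).
  exists (fun _ => f); split=> // _ x.
  apply: (big_ind (@in_disc R)) => [||i _].
  - exact: in_disc1.
  - exact: in_discM.
  - by case: ifP => _; [apply: in_disc_sign | apply: in_disc1].
move=> i0.
have prodf x : \prod_(j < #|Q|) f (x + y i0 *+ square_shifts j) =
    if s i0 then g (L i0 x) else 1.
  rewrite exchange_big (bigD1 i0) //= [X in _ * X]big1 ?mulr1 => [|i ne_i].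
    (* L i0 is constant along the direction y i0, and |Q| is odd. *)
    case: (s i0); last by rewrite big1.
    under eq_bigr do rewrite morphD_mulrn // Lii mul0r addr0.
    rewrite prodr_const card_ord /g.
    by case: zero_or_negsquare; rewrite ?expr1n // expr1 -signr_odd Qodd.
  (* The values of L i run through a translate of (L i (y i0)) Q = Q. *)
  case: (s i); last by rewrite big1.
  under eq_bigr do rewrite morphD_mulrn //.
  rewrite (prod_square_shifts (fun q => g (L i x + L i (y i0) * q))).
  have QL := Lij _ _ ne_i.
  rewrite -[RHS](prod_sign_shifted_squares R[i] (L i x) Q2).
  rewrite [RHS](reindex_inj (mulfI (nonzero_squaresN0 QL))) /=.
  by apply: eq_big => q //; rewrite nonzero_squaresMl.
rewrite /average (eq_bigr _ (fun x _ => prodf x)).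
have p0 : p%:R != 0 :> R[i] by rewrite pnatr_eq0 -lt0n prime_gt0.
case: (s i0); last first.
  rewrite sumr_const mulrC -[X in X / _]mulr_natl mulr1 divff //.
  by rewrite pnatr_eq0 -lt0n (cardD1 0).
have [e Le] := Lsurj i0.
have := average_comp_morphD g (LD i0) pp Le; rewrite /average => ->.
(* h takes the value 1 exactly |Q| + 1 times, and p = 2 |Q| + 1. *)
have -> : \sum_c g c = -1; last by rewrite mulrN1.
transitivity (\sum_(c : 'F_p) (1 - 2 * (zero_or_negsquare c)%:R) : R[i]).
  by apply: eq_bigr => c _; rewrite /g; case: zero_or_negsquare => /=; ring.
rewrite sumrB -mulr_sumr -natr_sum sumr_const.
have -> : (\sum_(c : 'F_p) zero_or_negsquare c = #|Q|.+1)%N.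
  rewrite -card_zero_or_negsquare -sum1_card [RHS]big_mkcond /=.
  by apply: eq_bigr => c _; rewrite inE; case: zero_or_negsquare.
have -> : #|xpredT : pred 'F_p| = #|Q|.*2.+1.
  exact: card_nonzero_squares (nonzero_squaresN0 Q2).
rewrite -addnn; rewrite !mulrS natrD; ring.
Qed.

(** * Forms and points whose pairing is a square *)

(** The constant coordinate adds one to the number of agreements of two words, so
    that p - 1 agreements give 0 modulo [p]. *)
Definition word_coordinate (p N : nat) : finType :=
  (unit + 'I_p.-1 * 'I_N)%type.

Definition word_vector (p N : nat) (A : {ffun 'I_p.-1 -> 'I_N})
    (t : word_coordinate p N) : 'F_p :=
  match t with inl _ => 1 | inr (j, c) => (A j == c)%:R end.

Lemma word_vector_dot (p N : nat) (A B : {ffun 'I_p.-1 -> 'I_N}) :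
  \sum_t word_vector A t * word_vector B t = (\sum_j (A j == B j)).+1%:R.
Proof.
rewrite big_sumType (big_pred1 tt) /=; last by case.
rewrite mulr1 -natr1 addrC; congr (_ + _).
transitivity (\sum_(j < p.-1) \sum_(c < N) (A j == c)%:R * (B j == c)%:R : 'F_p).
  by rewrite pair_bigA; apply: eq_bigr => -[].
rewrite natr_sum; apply: eq_bigr => j _.
rewrite (bigD1 (A j)) //= eqxx mul1r big1 ?addr0 1?eq_sym // => c.
by rewrite eq_sym => /negbTE ->; rewrite mul0r.
Qed.

(** The number of agreements lies between 0 and p - 1, so one more than it is
    divisible by [p] only when all p - 1 letters agree. *)
Lemma word_vector_dot_eq0 (p N : nat) (A B : {ffun 'I_p.-1 -> 'I_N}) :
  prime p -> (\sum_t word_vector A t * word_vector B t == 0) = (A == B).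
Proof.
move=> pp; have p0 := prime_gt0 pp.
rewrite word_vector_dot -(dvdn_pcharf (pchar_Fp pp)).
set m := (\sum_j _)%N.
have mE : (m + \sum_j (A j != B j) = p.-1)%N.
  rewrite -big_split /= -[RHS]card_ord -sum1_card.
  by apply: eq_bigr => j _; case: (_ == _).
apply/idP/eqP => [/dvdn_leq|AB].
  move=> /(_ isT) pm.
  have /eqP : (\sum_j (A j != B j) = 0)%N by lia.
  rewrite sum_nat_eq0 => /forallP AB; apply/ffunP => j.
  by have := AB j; rewrite /= eqb0 negbK => /eqP.
rewrite (_ : m = p.-1) ?prednK // -mE AB [X in (_ + X)%N]big1 ?addn0 //.
by move=> j _; rewrite eqxx.
Qed.

(** Tensoring the word vectors with themselves squares their dot products, so
    that the nonzero ones become nonzero squares. *)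
Lemma matching_family (p N : nat) :
  prime p ->
  exists (n : nat) (I : finType) (L : I -> 'rV['F_p]_n -> 'F_p)
         (y : I -> 'rV['F_p]_n),
    [/\ n = ((1 + p.-1 * N) ^ 2)%N, #|I| = (N ^ p.-1)%N
      & [/\ forall i, {morph L i : x z / x + z},
            forall i, exists e, L i e = 1,
            forall i, L i (y i) = 0
          & forall i j, i != j -> L i (y j) \in nonzero_squares 'F_p]].
Proof.
move=> pp; pose T := word_coordinate p N; pose n := #|{: T * T}|.
pose w2 A (i : 'I_n) : 'F_p :=
  let: (a, b) := enum_val i in word_vector A a * word_vector A b.
pose L A (z : 'rV['F_p]_n) := \sum_i w2 A i * z 0 i.
pose y B := \row_i w2 B i.
have LyE A B : L A (y B) = (\sum_t word_vector A t * word_vector B t) ^+ 2.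
  rewrite expr2 big_distrlr pair_bigA /=.
  rewrite [RHS](reindex (fun i : 'I_n => enum_val i)) /=.
    by apply: eq_bigr => i _; rewrite mxE /w2; case: enum_val => a b /=; ring.
  exact/onW_bij/enum_val_bij.
exists n, {ffun 'I_p.-1 -> 'I_N}, L, y; split.
- by rewrite /n card_prod card_sum card_unit card_prod !card_ord.
- by rewrite card_ffun !card_ord.
split=> [A x z|A|A|A B AB].
- by rewrite -big_split; apply: eq_bigr => i _; rewrite mxE mulrDr.
- (* The constant coordinate keeps L A from vanishing identically. *)
  exists (delta_mx 0 (enum_rank (inl tt, inl tt))).
  rewrite /L (bigD1 (enum_rank (inl tt, inl tt))) //= big1 => [|i ne].
    by rewrite mxE !eqxx /w2 enum_rankK /= !mulr1 addr0.
  by rewrite mxE (negbTE ne) andbF mulr0.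
- apply/eqP; rewrite LyE expf_eq0 /=.
  by rewrite word_vector_dot_eq0.
- rewrite LyE; apply/nonzero_squaresP; eexists; last by [].
  by rewrite word_vector_dot_eq0.
Qed.

(** * Signs with small correlations *)

Lemma expR_le_quadratic (R : realType) (y : R) :
  y <= 1 / 2 -> expR y <= 1 + y + 2 * y ^+ 2.
Proof.
move=> y2; have := expR_ge1Dx (- y); rewrite expRN => le.
have pos : 0 < 1 + y + 2 * y ^+ 2 by nra.
rewrite -[expR y]invrK -[leRHS]invrK lef_pV2 ?posrE ?invr_gt0 ?expR_gt0 //.
apply: le_trans le; rewrite -div1r ler_pdivrMr //; nra.
Qed.

(** The average over all signs [s] of the exponential of eta times the signed sum
    of [a j] is a product of hyperbolic cosines, each at most exp(2 eta^2).
    Summing over [j], some [s] has a total of at most |J| exp(2 eta^2 |I|), which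
    bounds each of its terms. *)
Lemma small_correlation_signs (R : realType) (I J : finType) (a : J -> I -> R)
    (delta : R) :
    (forall j i, `|a j i| <= 1) -> 0 < delta <= 1 ->
    #|J|%:R <= expR (delta ^+ 2 * #|I|%:R / 8) ->
  exists s : {ffun I -> bool},
    forall j, \sum_i (-1) ^+ s i * a j i <= delta * #|I|%:R.
Proof.
move=> a1 /andP[delta0 delta1] cardJ.
(* This choice makes 2 eta^2 equal to delta^2 / 8, half of eta delta. *)
pose eta := delta / 4.
pose W (s : {ffun I -> bool}) j := expR (eta * \sum_i (-1) ^+ s i * a j i).
pose C : R := #|J|%:R * expR (2 * eta ^+ 2 * #|I|%:R).
have totalW : \sum_s \sum_j W s j <= \sum_(s : {ffun I -> bool}) C.
  rewrite exchange_big sumr_const /=.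
  have -> : C *+ #|{ffun I -> bool}| =
      \sum_(j : J) (2 * expR (2 * eta ^+ 2)) ^+ #|I|.
    rewrite sumr_const card_ffun card_bool /C expRM_natr.
    set E := expR _; rewrite -[LHS]mulr_natr natrX -[RHS]mulr_natl exprMn.
    by rewrite -mulrA [_ * 2 ^+ _]mulrC.
  apply: ler_sum => j _.
  have -> : \sum_s W s j =
      \prod_i \sum_(b : bool) expR (eta * ((-1) ^+ b * a j i)).
    rewrite bigA_distr_bigA; apply: eq_bigr => s _.
    by rewrite /W mulr_sumr expR_sum.
  rewrite -prodr_const; apply: ler_prod => i _.
  rewrite big_bool /= expr1 expr0 mul1r mulN1r.
  rewrite addr_ge0 ?expR_ge0 //=.
  have /ler_normlP[an ap] := a1 j i.
  have e1 : eta * a j i <= 1 / 2 by rewrite /eta; nra.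
  have e2 : eta * - a j i <= 1 / 2 by rewrite /eta; nra.
  have := expR_le_quadratic e1; have := expR_le_quadratic e2.
  have := expR_ge1Dx (2 * eta ^+ 2).
  have aa : a j i ^+ 2 <= 1 by nra.
  have ee : 0 <= eta ^+ 2 by rewrite sqr_ge0.
  have : eta ^+ 2 * a j i ^+ 2 <= eta ^+ 2 by nra.
  lra.
have [s sP] : exists s, \sum_j W s j <= C.
  case: (pickP (fun s => \sum_j W s j <= C)) => [s|no]; first by exists s.
  exfalso; move: totalW; rewrite leNgt => /negP; apply.
  apply: ltr_sum => [|s _]; last by rewrite ltNge no.
  by apply/hasP; exists [ffun=> true]; rewrite ?mem_index_enum.
exists s => j.
have eta0 : 0 < eta by rewrite divr_gt0.
rewrite -(ler_pM2l eta0) -ler_expR.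
have : W s j <= C.
  apply: le_trans sP; rewrite (bigD1 j) //= lerDl.
  by apply: sumr_ge0 => *; apply: expR_ge0.
move=> /le_trans; apply; rewrite /C.
apply: le_trans (ler_wpM2r (expR_ge0 _) cardJ) _.
by rewrite -expRD ler_expR /eta; lra.
Qed.

(** * Counting polynomial phases *)

(** Every monomial of degree at most d + 1 arises from one of degree at most [d]
    by multiplication by a variable or by 1. *)
Lemma card_bmultinom_le n d : (#|{: 'X_{1..n < d.+1}}| <= n.+1 ^ d)%N.
Proof.
elim: d => [|d IH].
  rewrite expn0; apply/card_le1P => m _ m'; apply/esym/eqP/val_inj => /=.
  have /eqP : mdeg m = 0%N by apply/eqP; rewrite -leqn0 -ltnS bmdeg.
  have /eqP : mdeg m' = 0%N by apply/eqP; rewrite -leqn0 -ltnS bmdeg.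
  by rewrite !mdeg_eq0 => /eqP -> /eqP ->.
pose mul (mi : 'X_{1..n < d.+1} * option 'I_n) : 'X_{1..n} :=
  (mi.1 + if mi.2 is Some i then U_(i) else 0)%MM.
have mulP mi : (mdeg (mul mi) < d.+2)%N.
  rewrite mdegD -addSn -[d.+2]addn1 leq_add ?bmdeg //.
  by case: mi.2 => [i|]; rewrite ?mdeg1 ?mdeg0.
pose F mi : 'X_{1..n < d.+2} := BMultinom (mulP mi).
apply: (@leq_trans #|F @: setT|); last first.
  apply: leq_trans (leq_imset_card _ _) _.
  by rewrite cardsT card_prod card_option card_ord expnSr leq_mul2r IH orbT.
apply/subset_leq_card/subsetP => m _; apply/imsetP.
case: (ltnP (mdeg m) d.+1) => [lt_md|ge_md].
  exists (BMultinom lt_md, None); rewrite ?inE //.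
  by apply: val_inj => /=; rewrite /mul addm0.
have [i mi] : exists i, m i != 0%N.
  apply/existsP; rewrite -negb_forall; apply: contraTN ge_md => /forallP m0.
  by rewrite mdegE big1 // => i _; apply/eqP.
have Ui : (U_(i) <= m)%MM by rewrite lep1mP.
have lt_md : (mdeg (m - U_(i))%MM < d.+1)%N.
  by have := bmdeg m; rewrite -{1}(submK Ui) mdegD mdeg1 addn1.
exists (BMultinom lt_md, Some i); rewrite ?inE //.
by apply: val_inj; rewrite /= /mul /= submK.
Qed.

(** Makes the phases of bounded degree a family indexed by a finite type, over
    which [small_correlation_signs] can range. *)
Definition coef_phase (R : realType) (p n d : nat)
    (c : {ffun 'X_{1..n < d.+1} -> 'F_p}) (x : 'rV['F_p]_n) : R :=
  2 * pi * (nat_of_ord (\sum_m c m *: 'X_[m] : {mpoly 'F_p[n]}).@[x 0])%:R / p%:R.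

Lemma polynomial_phaseP (R : realType) (p n d : nat)
    (psi : 'rV['F_p]_n -> R[i]) :
  polynomial_phase d psi ->
  exists c : {ffun 'X_{1..n < d.+1} -> 'F_p},
    forall x, psi x = expi (coef_phase R c x).
Proof.
case=> P [Pd psiE]; exists [ffun m : 'X_{1..n < d.+1} => P@_m] => x.
rewrite psiE /coef_phase; congr (expi (_ * (nat_of_ord _.@[_])%:R / _)).
by rewrite {1}(mpolywE Pd); apply: eq_bigr => m _; rewrite ffunE.
Qed.

(** The real and imaginary parts of the phases, with both signs, are at most
    4 p^((n+1)^d) functions with values in [-1, 1]. *)
Lemma signs_uncorrelated_with_phases (R : realType) (p n d : nat) (I : finType)
    (y : I -> 'rV['F_p]_n) (delta : R) :
    prime p -> 0 < delta <= 1 ->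
    (4 * p ^ (n.+1 ^ d))%N%:R <= expR (delta ^+ 2 * #|I|%:R / 8) ->
  exists s : {ffun I -> bool}, forall psi, polynomial_phase d psi ->
    cabs (\sum_i (-1) ^+ s i * psi (y i)) <= 2 * delta * #|I|%:R.
Proof.
move=> pp delta01 card_le.
(* An element of J selects a sign, the real or imaginary part, and a phase. *)
pose J : finType := (bool * bool * {ffun 'X_{1..n < d.+1} -> 'F_p})%type.
pose a (j : J) i : R := let t := coef_phase R j.2 (y i) in
  (-1) ^+ j.1.1 * if j.1.2 then cos t else sin t.
have [||s sP] := @small_correlation_signs R I J a delta _ delta01.
- move=> [[b1 b2] c] i; rewrite normrM normrX normrN1 expr1n mul1r /=.
  by case: b2; [apply: cos_max | apply: sin_max].
- apply: le_trans card_le; rewrite ler_nat !card_prod card_bool card_ffun card_Fp //.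
  by rewrite leq_mul2l /= leq_exp2l ?prime_gt1 // card_bmultinom_le.
exists s => psi /(@polynomial_phaseP R)[c psiE].
under eq_bigr do rewrite psiE.
rewrite sum_sign_expi; apply: le_trans (cabs_le_ReIm _ _) _.
have corr b2 : `|\sum_i (-1) ^+ s i * (let t := coef_phase R c (y i) in
    if b2 then cos t else sin t)| <= delta * #|I|%:R.
  rewrite ler_norml lerNl -sumrN; apply/andP; split.
    have := sP ((true, b2), c); congr (_ <= _); apply: eq_bigr => i _.
    by rewrite /a /= expr1; ring.
  have := sP ((false, b2), c); congr (_ <= _); apply: eq_bigr => i _.
  by rewrite /a /= expr0 mul1r.
have := corr true; have := corr false; lra.
Qed.

(** Pairing with the signs [s] is linear, so signs that correlate with no phase
    certify that a function with a large signed sum has no decomposition of small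
    weight and small error. *)
Lemma decomposable_signed_sum_le (R : realType) (p n d : nat) (M eps delta : R)
    (I : finType) (y : I -> 'rV['F_p]_n) (s : I -> bool) phi :
    0 <= delta ->
    (forall psi : 'rV['F_p]_n -> R[i], polynomial_phase d psi ->
       cabs (\sum_i (-1) ^+ s i * psi (y i)) <= delta) ->
    decomposable d M eps phi ->
  cabs (\sum_i (-1) ^+ s i * phi (y i)) <= M * delta + eps * #|I|%:R.
Proof.
move=> delta0 uncorr [r [alpha [psi [tau [alphaM psiP tau_eps phiE]]]]].
have -> : \sum_i (-1) ^+ s i * phi (y i) =
    \sum_j alpha j * (\sum_i (-1) ^+ s i * psi j (y i))
    + \sum_i (-1) ^+ s i * tau (y i).
  under [X in X + _]eq_bigr do rewrite mulr_sumr.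
  rewrite exchange_big -big_split /=; apply: eq_bigr => i _.
  rewrite phiE mulrDr mulr_sumr; congr (_ + _); apply: eq_bigr => j _.
  by rewrite mulrCA.
apply: le_trans (le_normcD _ _) _; apply: lerD.
  apply: le_trans (cabs_sum _) _.
  apply: (@le_trans _ _ (\sum_j cabs (alpha j) * delta)); last first.
    by rewrite -mulr_suml ler_wpM2r.
  apply: ler_sum => j _; rewrite /cabs ComplexField.Normc.normcM.
  apply: ler_wpM2l; last exact: uncorr.
  by case: (alpha j) => u v /=; apply: sqrtr_ge0.
apply: le_trans (cabs_sum _) _.
rewrite mulr_natr -sumr_const; apply: ler_sum => i _.
rewrite /cabs ComplexField.Normc.normcM.
apply: (@le_trans _ _ (cabs (tau (y i)))).
  rewrite ler_piMl //; last exact: in_disc_sign.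
  by case: (tau (y i)) => u v /=; apply: sqrtr_ge0.
by apply: le_trans tau_eps; rewrite /Linfty_norm (bigD1 (y i)) //= le_max lexx.
Qed.

(** * The lower bound against the upper bound *)

(** The number of variables is of order N^2 and 2 (k - 1) < p - 1, so for large
    [N] the phases are few in comparison with the N^(p-1) points. *)
Lemma eventually_small_entropy (R : realType) (p k : nat) (delta : R) :
    (1 < p)%N -> p = k.*2.+1 -> 0 < delta ->
  exists2 N : nat, (0 < N)%N &
    (4 * p ^ (((1 + p.-1 * N) ^ 2).+1 ^ k.-1))%N%:R <=
      expR (delta ^+ 2 * (N ^ p.-1)%:R / 8).
Proof.
move=> p1 pk delta0.
(* The constant for which the claim reduces to C <= N^2. *)
pose C : R := (p + 4)%:R * (2 * p)%:R ^+ (2 * k.-1) * 8 / delta ^+ 2.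
pose N := (Num.truncn C).+1.
have CN : C <= N%:R by apply/ltW/truncnS_gt.
exists N => //; set D := (_ ^ k.-1)%N.
have D0 : (0 < D)%N by rewrite expn_gt0.
have N0 : (0 < N)%N by [].
have DN : (D <= (2 * p) ^ (2 * k.-1) * N ^ (2 * k.-1))%N.
  rewrite -expnMn expnM /D; case: (posnP k.-1) => [->|kpos]; first by rewrite !expn0.
  rewrite leq_exp2r //.
  have le1 : (1 + p.-1 * N <= p * N)%N.
    by rewrite -[in leqRHS](prednK (ltnW p1)) mulSn leq_add2r.
  have le2 : ((1 + p.-1 * N) ^ 2 <= (p * N) ^ 2)%N by rewrite leq_exp2r.
  have pN0 : (0 < (p * N) ^ 2)%N by rewrite expn_gt0 muln_gt0 (ltnW p1).
  have -> : ((2 * p * N) ^ 2 = 4 * (p * N) ^ 2)%N by rewrite -mulnA expnMn.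
  lia.
have k0 : (0 < k)%N by case: k pk {C N CN D D0 DN N0} p1 => [->|].
have NE : (N ^ p.-1 = N ^ (2 * k.-1) * N ^ 2)%N.
  by rewrite -expnD pk -muln2; congr (_ ^ _)%N; lia.
apply: (@le_trans _ _ (expR ((p + 4)%:R * D%:R))).
  apply: (@le_trans _ _ (expR 4 * expR p%:R ^+ D)).
    have le_expR (x : R) : x <= expR x.
      by apply: le_trans (expR_ge1Dx x); rewrite lerDr ler01.
    rewrite natrM natrX; apply: ler_pM => //; first exact: exprn_ge0.
    by rewrite lerXn2r ?nnegrE ?expR_ge0.
  rewrite -expRM_natr -expRD ler_expR natrD.
  have : 1 <= D%:R :> R by rewrite ler1n.
  lra.
rewrite ler_expR NE natrM [(N ^ 2)%N%:R]natrX.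
have CE : delta ^+ 2 * C / 8 = (p + 4)%:R * (2 * p)%:R ^+ (2 * k.-1).
  by rewrite /C; field; rewrite gt_eqF.
apply: (@le_trans _ _ (delta ^+ 2 * C / 8 * (N ^ (2 * k.-1))%:R)).
  rewrite CE -mulrA ler_wpM2l // -natrX -natrM ler_nat //.
have N1 : 1 <= N%:R :> R by rewrite ler1n.
have CN2 : C <= N%:R ^+ 2 by nra.
rewrite [leRHS](_ : _ = delta ^+ 2 * N%:R ^+ 2 / 8 * (N ^ (2 * k.-1))%:R); last by ring.
do 2 apply: ler_wpM2r => //; first by rewrite invr_ge0.
by apply: ler_wpM2l; rewrite ?sqr_ge0.
Qed.

Lemma error_terms_lt (R : realFieldType) (P M l : R) :
  0 < P -> 0 < M -> 0 < l ->
  M * (2 * (6 * P * (M + 1))^-1 * l) + (3 * P)^-1 * l < l / P.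
Proof.
move=> P0 M0 l0; have M1 : 0 < M + 1 by rewrite addr_gt0.
have -> : M * (2 * (6 * P * (M + 1))^-1 * l) + (3 * P)^-1 * l =
    l / P * ((2 * M + 1) / (3 * (M + 1))).
  by field; rewrite !gt_eqF.
rewrite -[ltRHS]mulr1 ltr_pM2l ?divr_gt0 // ltr_pdivrMr ?mulr_gt0 //; lra.
Qed.

Theorem theorem1p2 (R : realType) :
  forall N : nat, exists p : nat,
    [/\ (N < p)%N, prime p
      & exists (k : nat) (v : 'I_k -> nat),
          [/\ (2 <= k)%N, (k.+1 <= p)%N
            & ~ (forall eps : R, 0 < eps ->
                   exists M : R, 0 < M /\
                     forall n : nat, (0 < n)%N ->
                       forall phi : 'rV['F_p]_n -> R[i],
                         dual_function v phi ->
                         decomposable k.-1 M eps phi)]].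
Proof.
move=> N0.
(* The bound p > 3 makes k at least 2. *)
have [p [Np pp p3 [b b2]]] := prime_3_mod_4_with_sqrt2 (maxn N0 3).
move: Np; rewrite gtn_max => /andP[Np lt3p].
exists p; split=> //; pose k := #|nonzero_squares 'F_p|.
exists k, (@square_shifts p).
have two0 : (2 : 'F_p) != 0.
  rewrite -(dvdn_pcharf (pchar_Fp pp)); apply/negP => /dvdn_leq; lia.
have Q2 : 2 \in nonzero_squares 'F_p.
  apply/nonzero_squaresP; exists b => //.
  by apply: contraNneq two0 => b0; rewrite -b2 b0 expr0n.
have pk : p = k.*2.+1 by rewrite -card_nonzero_squares // card_Fp.
have kodd : odd k by lia.
split=> [||H]; [lia | lia |].
have p0 : 0 < p%:R :> R by rewrite ltr0n prime_gt0.
(* The signed sum of phi over the l points is at least l / p; with these eps and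
   delta, each of the two error terms is at most l / (3 p). *)
have [|M [M0 {}H]] := H (3 * p%:R)^-1; first by rewrite invr_gt0 mulr_gt0.
pose delta : R := (6 * p%:R * (M + 1))^-1.
have p1 : 1 <= p%:R :> R by rewrite ler1n prime_gt0.
have den1 : 1 <= 6 * p%:R * (M + 1) by nra.
have delta01 : 0 < delta <= 1.
  by rewrite invr_gt0 invf_le1 // ?den1 ?andbT; apply: lt_le_trans den1.
have /andP[delta0 _] := delta01.
have [N Npos small] := eventually_small_entropy (prime_gt1 pp) pk delta0.
have [n [I [L [y [cardn cardI [LD Lsurj Lii Lij]]]]]] := matching_family N pp.
have [|s uncorr] := @signs_uncorrelated_with_phases R p n k.-1 _ y delta pp delta01.
  by rewrite cardI cardn.
have [phi dual_phi phiE] := dual_function_of_signs R s pp Q2 kodd LD Lsurj Lii Lij.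
have npos : (0 < n)%N by rewrite cardn expn_gt0.
set l : R := #|I|%:R in uncorr.
have l0 : 0 < l by rewrite ltr0n cardI expn_gt0 Npos.
have dl0 : 0 <= 2 * delta * l by rewrite !mulr_ge0 // ltW.
have := decomposable_signed_sum_le dl0 uncorr (H n npos phi dual_phi).
rewrite -/l; apply/negP; rewrite -ltNge; apply: lt_le_trans (Re_le_cabs _).
apply: (@lt_le_trans _ _ (l / p%:R)); last first.
  have -> : \sum_i (-1) ^+ s i * phi (y i) =
      (\sum_i if s i then p%:R^-1 else 1)%:C%C.
    rewrite rmorph_sum; apply: eq_bigr => i _; rewrite phiE.
    case: (s i); last by rewrite expr0 mul1r.
    by rewrite expr1 mulN1r opprK fmorphV rmorph_nat.
  rewrite /= mulr_natl -sumr_const; apply: ler_sum => i _.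
  by case: (s i) => //; rewrite invf_le1.
exact: error_terms_lt.
Qed.
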